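(* Let $d \ge 2$ and $r \ge 1$ be integers, and let $\mathcal{W} \in \mathbb{R}^{2 \times \cdots \times 2}$ be a $d$-dimensional weight tensor given in the Tensor Train format with TT-rank $r$, i.e. given by TT-cores $G_1, \ldots, G_d$ with $\mathcal{W}_{i_1 \ldots i_d} = G_1[i_1] \cdots G_d[i_d]$ for all $(i_1,\ldots,i_d) \in \{0,1\}^d$. Then for a feature vector $x = (x_1,\ldots,x_d) \in \mathbb{R}^d$ the model response $$\widehat{y}(x) = \sum_{i_1=0}^1 \cdots \sum_{i_d=0}^1 \mathcal{W}_{i_1 \ldots i_d} \prod_{k=1}^d x_k^{i_k}$$ can be computed (from the entries of the TT-cores $G_1,\ldots,G_d$ and of $x$) in $O(r^2 d)$ FLOPS.
   Context: Convention: $0^0 = 1$. Tensor Train (TT) format: a $d$-dimensional tensor $\mathcal{A}$ of size $2 \times \cdots \times 2$, with indices $i_k \in \{0,1\}$, is represented in the TT-format with TT-rank $r$ if each of its elements is given as $\mathcal{A}_{i_1 \ldots i_d} = G_1[i_1] G_2[i_2] \cdots G_d[i_d]$, where for each value of the indices $G_1[i_1]$ is a $1 \times r$ real row vector, $G_k[i_k]$ is an $r \times r$ real matrix for $k = 2, \ldots, d-1$, and $G_d[i_d]$ is an $r \times 1$ real column vector. The collection $G_k = (G_k[0], G_k[1])$ is called the $k$-th TT-core. The number $r$ (the size of the slices in the given representation) is called the TT-rank. FLOPS means the number of real arithmetic operations (additions and multiplications). The constant in $O(r^2 d)$ is absolute: it does not depend on $r$, $d$, $x$ or the TT-cores. 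*)

(* Defs.v *)
From HB Require Import structures.
From mathcomp Require Import all_boot all_order all_algebra.
From mathcomp Require Import reals.

Set Implicit Arguments.
Unset Strict Implicit.
Unset Printing Implicit Defensive.

Import GRing.Theory.

Local Open Scope ring_scope.

Definition tensor (R : realType) (d : nat) : Type := {ffun 'I_d -> 'I_2} -> R.

(* Modes are numbered 0, ..., d.-1; mid_core G k is the core of mode k.+1. *)
Record tt_cores (R : realType) (d r : nat) : Type := TTCores {
  first_core : 'I_2 -> 'rV[R]_r;
  mid_core : 'I_(d - 2) -> 'I_2 -> 'M[R]_r;
  last_core : 'I_2 -> 'cV[R]_r
}.

Definition first_mode (d : nat) (hd : (2 <= d)%N) : 'I_d := Ordinal (ltnW hd).

Lemma mid_mode_subproof (d : nat) (k : 'I_(d - 2)) : (k.+1 < d)%N.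
Proof. by have := ltn_ord k; rewrite ltn_subRL add2n => /ltnW. Qed.

Definition mid_mode (d : nat) (k : 'I_(d - 2)) : 'I_d :=
  Ordinal (mid_mode_subproof k).

Lemma last_mode_subproof (d : nat) : (2 <= d)%N -> (d.-1 < d)%N.
Proof. by case: d. Qed.

Definition last_mode (d : nat) (hd : (2 <= d)%N) : 'I_d :=
  Ordinal (last_mode_subproof hd).

(* The (noncommutative) big product multiplies in increasing order of k; for
   d = 2 it is the identity matrix. *)
Definition tt_entry (R : realType) (d r : nat) (hd : (2 <= d)%N)
    (G : tt_cores R d r) (i : {ffun 'I_d -> 'I_2}) : R :=
  (first_core G (i (first_mode hd))
   *m (\big[mulmx/1%:M]_(k < d - 2) mid_core G k (i (mid_mode k)))
   *m last_core G (i (last_mode hd))) 0 0.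

Definition in_tt_format (R : realType) (d r : nat) (hd : (2 <= d)%N)
    (W : tensor R d) (G : tt_cores R d r) : Prop :=
  forall i : {ffun 'I_d -> 'I_2}, W i = tt_entry hd G i.

(* x ^+ 0 = 1 for every x, including x = 0. *)
Definition model_response (R : realType) (d : nat) (W : tensor R d)
    (x : 'rV[R]_d) : R :=
  \sum_(i : {ffun 'I_d -> 'I_2}) W i * \prod_(k < d) x 0 k ^+ i k.

(* Straight-line arithmetic programs whose available values are named by V.
   Each instruction computes one sum or product of two available values and
   makes the result available to the rest of the program under the fresh name
   None, the earlier names v becoming Some v. There are no constants: the only
   initial values are the inputs. *)
Inductive slp (V : Type) : Type :=
| Ret of V
| Add of V & V & slp (option V)
| Mul of V & V & slp (option V).

Fixpoint flops (V : Type) (p : slp V) : nat :=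
  match p with
  | Ret _ => 0
  | Add _ _ q => (flops q).+1
  | Mul _ _ q => (flops q).+1
  end.

Definition extend (T V : Type) (env : V -> T) (a : T) (o : option V) : T :=
  if o is Some v then env v else a.

Fixpoint eval_slp (R : realType) (V : Type) (env : V -> R) (p : slp V) : R :=
  match p with
  | Ret v => env v
  | Add u v q => eval_slp (extend env (env u + env v)) q
  | Mul u v q => eval_slp (extend env (env u * env v)) q
  end.

Inductive tt_input (d r : nat) : Type :=
| FirstEntry of 'I_2 & 'I_r
| MidEntry of 'I_(d - 2) & 'I_2 & 'I_r & 'I_r
| LastEntry of 'I_2 & 'I_r
| Feature of 'I_d.

Definition tt_input_value (R : realType) (d r : nat) (G : tt_cores R d r)
    (x : 'rV[R]_d) (v : tt_input d r) : R :=
  match v with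
  | FirstEntry i b => first_core G i 0 b
  | MidEntry k i a b => mid_core G k i a b
  | LastEntry i a => last_core G i a 0
  | Feature k => x 0 k
  end.

(* Main.v *)
(** Contracting every mode k with the vector (1, x_k) turns core k into the
    matrix G_k[0] + x_k G_k[1], and by distributivity the response is the
    product of these d matrices.  Forming one costs at most 2r^2 operations, and
    multiplying from left to right only ever multiplies a row vector by a
    matrix, at a further 2r^2 operations per mode. *)

Require Import Defs.
From mathcomp Require Import all_boot all_order all_algebra.
From mathcomp Require Import boolp classical_sets reals.
From mathcomp Require Import zify.
Set Implicit Arguments.
Unset Strict Implicit.
Unset Printing Implicit Defensive.
Import GRing.Theory.
Local Open Scope classical_set_scope.
Local Open Scope ring_scope.

(** * Factorization of the response through the contracted cores *)

Lemma big_modes (T : Type) (one : T) (op : Monoid.com_law one) (d : nat)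
    (hd : (2 <= d)%N) (F : 'I_d -> T) :
  \big[op/one]_(k < d) F k =
  op (op (F (first_mode hd)) (\big[op/one]_(k < d - 2) F (mid_mode k)))
     (F (last_mode hd)).
Proof.
case: d hd F => [|[|n]] // hd F.
rewrite big_ord_recl big_ord_recr /= Monoid.mulmA.
have En : (n.+2 - 2)%N = n by rewrite subn2.
congr (op (op _ _) _); try by congr F; apply: val_inj.
rewrite (reindex _ (onW_bij _ (Bijective (cast_ordK En) (cast_ordKV En)))) /=.
by apply: eq_bigr => i _; congr F; apply: val_inj.
Qed.

Lemma scaler_mxprod (R : realType) (I : Type) (r : nat) (s : seq I)
    (c : I -> R) (M : I -> 'M[R]_r) :
  \big[mulmx/1%:M]_(k <- s) (c k *: M k) =
  (\prod_(k <- s) c k) *: \big[mulmx/1%:M]_(k <- s) M k.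
Proof.
apply: (big_ind3 (fun A b B => A = b *: B)) => // [|A b B A' b' B' -> ->].
  by rewrite scale1r.
by rewrite -scalemxAl -scalemxAr scalerA.
Qed.

Definition mode_values (d : nat) (hd : (2 <= d)%N)
    (i : {ffun 'I_d -> 'I_2}) : 'I_2 * {ffun 'I_(d - 2) -> 'I_2} * 'I_2 :=
  (i (first_mode hd), [ffun k => i (mid_mode k)], i (last_mode hd)).

(** For a nonzero mode [k], [insub k.-1] succeeds exactly on the middle modes. At the last mode
    [k.-1] equals [d - 2], just out of range, so the default [t.2] of [oapp] is returned there. *)
Definition mode_join (d : nat)
    (t : 'I_2 * {ffun 'I_(d - 2) -> 'I_2} * 'I_2) : {ffun 'I_d -> 'I_2} :=
  [ffun k : 'I_d => if k == 0 :> nat then t.1.1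
     else oapp t.1.2 t.2 (insub k.-1)].

Lemma mode_joinK d (hd : (2 <= d)%N) : cancel (@mode_join d) (mode_values hd).
Proof.
move=> [[a f] b]; rewrite /mode_values !ffunE /=; congr (_, _, _).
  by apply/ffunP => k; rewrite !ffunE /= valK.
case: d hd f => [|[|n]] //= hd f.
by rewrite insubF // subn2 /= ltnn.
Qed.

Lemma mode_valuesK d (hd : (2 <= d)%N) : cancel (mode_values hd) (@mode_join d).
Proof.
move=> i; apply/ffunP => k; rewrite ffunE /=.
have [k0|k0] := eqVneq (k : nat) 0%N; first by congr (i _); apply: val_inj.
case: insubP => [j _ jE | ] /=.
  by rewrite ffunE; congr (i _); apply: val_inj; rewrite /= jE prednK // lt0n.
rewrite -leqNgt => le; congr (i _); apply: val_inj => /=.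
have := ltn_ord k; move: le k0; case: d hd {i} k => [|[|n]] //= _ [[|k] /= kP] //.
rewrite subn2 /= !ltnS => nk _ kn.
by apply/eqP; rewrite eqSS eqn_leq nk kn.
Qed.

Definition contracted (R : realType) (m n : nat) (x : R)
    (M : 'I_2 -> 'M[R]_(m, n)) : 'M[R]_(m, n) := \sum_(c < 2) x ^+ c *: M c.

(** Expanding the three factors on the right gives a sum over triples of first, middle and last
    indices. The bijection [mode_values] turns it into a sum over multi-indices, and pulling the
    scalars out of each matrix product leaves the monomial in [x] times the tensor entry. *)
Lemma model_response_factor (R : realType) (d r : nat) (hd : (2 <= d)%N)
    (W : tensor R d) (G : tt_cores R d r) (x : 'rV[R]_d) :
  in_tt_format hd W G ->
  model_response W x =
  (contracted (x 0 (first_mode hd)) (first_core G)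
   *m (\big[mulmx/1%:M]_(k < d - 2)
         contracted (x 0 (mid_mode k)) (mid_core G k))
   *m contracted (x 0 (last_mode hd)) (last_core G)) 0 0.
Proof.
move=> WG; rewrite /contracted.
have -> : \big[mulmx/1%:M]_(k < d - 2)
      \sum_(c < 2) x 0 (mid_mode k) ^+ c *: mid_core G k c =
    \sum_(f : {ffun 'I_(d - 2) -> 'I_2}) \big[mulmx/1%:M]_(k < d - 2)
      (x 0 (mid_mode k) ^+ f k *: mid_core G k (f k)).
  (* Distributivity keeps the factors in order, so it applies to the noncommutative [mulmx], read as
     the ring product of ['M_r]. *)
  exact: (bigA_distr_bigA (times := ( *%R : 'M[R]_r -> 'M[R]_r -> 'M[R]_r))).
rewrite mulmx_suml; under eq_bigr => a _ do rewrite mulmx_sumr.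
rewrite pair_bigA mulmx_suml; under eq_bigr => t _ do rewrite mulmx_sumr.
rewrite pair_bigA /=.
rewrite summxE (reindex (mode_values hd)) /=; last first.
  exact: onW_bij (Bijective (mode_valuesK hd) (@mode_joinK d hd)).
apply: eq_bigr => i _; rewrite WG /tt_entry (big_modes _ hd) /=.
under [in RHS]eq_bigr => k _ do rewrite ffunE.
rewrite scaler_mxprod -scalemxAr -!scalemxAl -scalemxAr -!scalemxAl !scalerA.
by rewrite [in RHS]mxE mulrC; congr (_ * _); rewrite mulrC mulrA.
Qed.

(* The parameter t : T ranges over the possible inputs, so that a name denotes a
   function of the input and one program has to work for all inputs. *)
Definition available (R : realType) (T V : Type) (env : T -> V -> R) :
    set (T -> R) :=
  range (fun v t => env t v).

(* n operations suffice to extend any environment naming the functions in A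
   to one that also names those in B.  Programs are composed in
   continuation-passing style because each instruction changes the type of
   names. *)
Definition derivable (R : realType) (T : Type) (n : nat)
    (A B : set (T -> R)) : Prop :=
  forall (V : Type) (env : T -> V -> R), A `<=` available env ->
  exists (V' : Type) (env' : T -> V' -> R),
    [/\ available env `<=` available env', B `<=` available env' &
      forall q : slp V', exists2 p : slp V, (flops p <= n + flops q)%N &
        forall t, eval_slp (env t) p = eval_slp (env' t) q].

(** * Rules for composing operation counts *)

Section Derivable.
Variables (R : realType) (T : Type).
Implicit Types (A B C : set (T -> R)) (f g : T -> R).

(** The continuation is [Ret v], where [v] names [f] in the final environment. It performs no
    operation, so the whole program costs at most [n]. *)
Lemma derivable_slp n (V : Type) (env : T -> V -> R) f :
  derivable n (available env) [set f] ->
  exists2 p : slp V, (flops p <= n)%N & forall t, eval_slp (env t) p = f t.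
Proof.
move=> /(_ V env (@subset_refl _ _)) [V' [env' [_ /(_ f erefl) [v _ <-]]]].
by move=> /(_ (Ret v)) [p]; rewrite addn0 => np pE; exists p.
Qed.

Lemma derivable_refl A B : B `<=` A -> derivable 0 A B.
Proof.
move=> BA V env Aenv; exists V, env; split=> // [|q]; last by exists q.
exact: subset_trans Aenv.
Qed.

Lemma derivableW n n' A A' B B' : (n <= n')%N -> A `<=` A' -> B' `<=` B ->
  derivable n A B -> derivable n' A' B'.
Proof.
move=> le AA BB AB V env A'env.
have [V' [env' [sub Benv' prog]]] := AB V env (subset_trans AA A'env).
exists V', env'; split=> // [|q]; first exact: subset_trans Benv'.
by have [p np pE] := prog q; exists p => //; rewrite (leq_trans np) ?leq_add2r.
Qed.

(** The second derivation starts from the environment left by the first, so intermediate results are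
    shared. A continuation is pulled back through the second derivation, then through the first. *)
Lemma derivable_trans n m A B C :
  derivable n A B -> derivable m (A `|` B) C -> derivable (n + m) A (B `|` C).
Proof.
move=> AB BC V env Aenv.
have [V1 [env1 [sub1 Benv1 prog1]]] := AB V env Aenv.
have [|V2 [env2 [sub2 Cenv2 prog2]]] := BC V1 env1.
  by rewrite subUset; split=> //; apply: subset_trans sub1.
exists V2, env2; split; first exact: subset_trans sub2.
  by rewrite subUset; split=> //; apply: subset_trans sub2.
move=> q; have [q1 nq1 q1E] := prog2 q; have [p np pE] := prog1 q1.
exists p; first by rewrite -addnA (leq_trans np) ?leq_add2l.
by move=> t; rewrite pE.
Qed.

Lemma derivable_comp n m A B C :
  derivable n A B -> derivable m (A `|` B) C -> derivable (n + m) A C.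
Proof. by move=> AB /(derivable_trans AB); apply: derivableW => // f; right. Qed.

(** Treats [Add] and [Mul] together: the result is named [None], and old names survive under
    [Some]. *)
Lemma derivable_instr (op : R -> R -> R)
    (instr : forall V : Type, V -> V -> slp (option V) -> slp V) :
  (forall V u v q, flops (instr V u v q) = (flops q).+1) ->
  (forall V u v q (env : V -> R), eval_slp env (instr V u v q) =
    eval_slp (extend env (op (env u) (env v))) q) ->
  forall A f g, A f -> A g -> derivable 1 A [set fun t => op (f t) (g t)].
Proof.
move=> flopsE evalE A f g Af Ag V env Aenv.
have [[u _ uf] [v _ vg]] := (Aenv f Af, Aenv g Ag).
exists (option V), (fun t => extend (env t) (op (env t u) (env t v))).
split=> [h [w _ <-]|h ->|q]; first by exists (Some w).
  by exists None => //; rewrite -uf -vg.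
by exists (instr V u v q) => [|t]; rewrite ?flopsE ?evalE.
Qed.

Lemma derivable_add A f g : A f -> A g -> derivable 1 A [set f \+ g].
Proof. exact: (@derivable_instr +%R Add). Qed.

Lemma derivable_mul A f g : A f -> A g -> derivable 1 A [set f \* g].
Proof. exact: (@derivable_instr *%R Mul). Qed.

Lemma derivable_muladd A f g h : A f -> A g -> A h ->
  derivable 2 A [set f \+ (g \* h)].
Proof.
move=> Af Ag Ah; apply: (@derivable_comp 1 1 _ [set g \* h]).
  exact: derivable_mul.
by apply: derivable_add; [left|right].
Qed.

Lemma derivable_family (J : finType) n A (F : J -> T -> R) :
  (forall j, derivable n A [set F j]) -> derivable (#|J| * n) A (range F).
Proof.
move=> AF; rewrite cardE.
apply: (@derivableW (size (enum J) * n) _ A _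
  [set F j | j in [set` enum J]]) => //.
  by move=> f [j _ <-]; exists j => //=; rewrite mem_enum.
elim: (enum J) => [|j s IHs] /=.
  by apply: derivable_refl => f [].
rewrite mulSn.
have AS : derivable (size s * n) (A `|` [set F j]) [set F k | k in [set` s]].
  by apply: derivableW IHs => // f; left.
apply: derivableW (derivable_trans (AF j) AS) => // f [k /= + <-].
by rewrite inE => /predU1P[->|ks]; [left|right; exists k].
Qed.

(** One multiplication starts the sum and each further term costs a multiplication and an addition.
    The condition [0 < n] excludes the empty sum, since programs have no constant 0 to return. *)
Lemma derivable_dot n A (F G : 'I_n -> T -> R) :
  (0 < n)%N -> (forall j, A (F j)) -> (forall j, A (G j)) ->
  derivable (2 * n) A [set fun t => \sum_(j < n) F j t * G j t].
Proof.
case: n F G => // n F G _ AF AG.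
elim: n F G AF AG => [|n IHn] F G AF AG.
  apply: (derivableW _ _ _ (derivable_mul (AF ord0) (AG ord0))) => // _ ->.
  by apply/funext => t; rewrite big_ord1.
set s := fun t => \sum_(j < n.+1) F (lift ord0 j) t * G (lift ord0 j) t.
apply: (@derivableW (2 * n.+1 + 2) _ A _
    [set s \+ (F ord0 \* G ord0)]) => //.
- by rewrite -mulnSr.
- by move=> _ ->; apply/funext => t; rewrite big_ord_recl addrC.
apply: (derivable_comp (IHn _ _ (fun j => AF (lift ord0 j)) (fun j => AG _))).
by apply: derivable_muladd; [right|left|left].
Qed.

Definition entries (m n : nat) (M : T -> 'M[R]_(m, n)) : set (T -> R) :=
  range (fun (ij : 'I_m * 'I_n) t => M t ij.1 ij.2).

(** Since [x ^+ 0 = 1] and [x ^+ 1 = x], each entry is [M 0 + x * M 1]: two operations. *)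
Lemma derivable_contracted A (m n : nat) (x : T -> R)
    (M : T -> 'I_2 -> 'M[R]_(m, n)) :
  A x -> (forall c, entries (M ^~ c) `<=` A) ->
  derivable (m * n * 2) A (entries (fun t => contracted (x t) (M t))).
Proof.
move=> Ax AM.
have -> : (m * n)%N = #|{: 'I_m * 'I_n}| by rewrite card_prod !card_ord.
apply: derivable_family => -[i j] /=.
have AMij c : A (fun t => M t c i j) by apply: (AM c); exists (i, j).
apply: derivableW (derivable_muladd (AMij 0) Ax (AMij 1)) => // _ ->.
apply/funext => t; rewrite /contracted summxE big_ord_recl big_ord1 !mxE.
by rewrite expr0 mul1r expr1; congr (_ + _ * M t _ _ _); apply: val_inj.
Qed.

Lemma derivable_mulmx A (m n p : nat) (M : T -> 'M[R]_(m, n))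
    (N : T -> 'M[R]_(n, p)) :
  (0 < n)%N -> entries M `<=` A -> entries N `<=` A ->
  derivable (m * p * (2 * n)) A (entries (fun t => M t *m N t)).
Proof.
move=> n0 AM AN.
have -> : (m * p)%N = #|{: 'I_m * 'I_p}| by rewrite card_prod !card_ord.
apply: derivable_family => -[i k] /=.
have AMi j : A (fun t => M t i j) by apply: AM; exists (i, j).
have ANk j : A (fun t => N t j k) by apply: AN; exists (j, k).
apply: derivableW (derivable_dot n0 AMi ANk) => // _ ->.
by apply/funext => t; rewrite mxE.
Qed.

(** The induction absorbs one factor at a time into [u], so both [u] and [A] must vary. For a row
    vector, [m = 1], each absorption is quadratic in [n]; the identity matrix is never computed. *)
Lemma derivable_mulmx_prod A (I : Type) (s : seq I) (c m n : nat)
    (u : T -> 'M[R]_(m, n)) (M : I -> T -> 'M[R]_n) :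
  (0 < n)%N -> entries u `<=` A -> (forall i, derivable c A (entries (M i))) ->
  derivable (size s * (c + m * n * (2 * n))) A
    (entries (fun t => u t *m \big[mulmx/1%:M]_(i <- s) M i t)).
Proof.
move=> n0; elim: s A u => [|i s IHs] A u Au AM /=.
  apply: derivable_refl => _ [jk _ <-]; apply: Au; exists jk => //.
  by apply/funext => t; rewrite big_nil mulmx1.
rewrite mulSn.
have AuM : derivable (c + m * n * (2 * n)) A (entries (fun t => u t *m M i t)).
  apply: (derivable_comp (AM i)); apply: derivable_mulmx => // f.
  by move=> /Au; left.
set B := entries (fun t => u t *m M i t).
have ABM j : derivable c (A `|` B) (entries (M j)).
  by apply: derivableW (AM j) => // f; left.
have := derivable_comp AuM (IHs _ _ (@subsetUr _ A B) ABM).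
apply: derivableW => // f [jk _ <-]; exists jk => //.
by apply/funext => t; rewrite big_cons mulmxA.
Qed.

End Derivable.

(** * Operation count for the whole response *)

Lemma derivable_model (R : realType) (d r : nat) (hd : (2 <= d)%N) :
  (1 <= r)%N ->
  derivable (4 * (r ^ 2 * d))
    (available (fun t : tt_cores R d r * 'rV[R]_d => tt_input_value t.1 t.2))
    [set fun t : tt_cores R d r * 'rV[R]_d =>
      (contracted (t.2 0 (first_mode hd)) (first_core t.1)
       *m (\big[mulmx/1%:M]_(k < d - 2)
             contracted (t.2 0 (mid_mode k)) (mid_core t.1 k))
       *m contracted (t.2 0 (last_mode hd)) (last_core t.1)) 0 0].
Proof.
move=> hr; set input := (X in available X); set A := available input.
have AX k : A (fun t => t.2 0 k) by exists (Feature r k).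
pose first t := contracted (input t (Feature r (first_mode hd))) (first_core t.1).
pose mid k t := contracted (input t (Feature r (mid_mode k))) (mid_core t.1 k).
pose last t := contracted (input t (Feature r (last_mode hd))) (last_core t.1).
have AF : derivable (1 * r * 2) A (entries first).
  apply: (derivable_contracted (AX _)) => c _ [[i b] _ <-].
  by exists (FirstEntry _ c b) => //; apply/funext => t; rewrite (ord1 i).
have AM k : derivable (r * r * 2) A (entries (mid k)).
  apply: (derivable_contracted (AX _)) => c _ [[a b] _ <-].
  by exists (MidEntry k c a b).
have AL : derivable (r * 1 * 2) A (entries last).
  apply: (derivable_contracted (AX _)) => c _ [[a j] _ <-].
  by exists (LastEntry _ c a) => //; apply/funext => t; rewrite (ord1 j).
set B := entries first.
have ABM k : derivable (r * r * 2) (A `|` B) (entries (mid k)).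
  by apply: derivableW (AM k) => // f; left.
pose row t := first t *m \big[mulmx/1%:M]_(k < d - 2) mid k t.
have Arow : derivable _ A (entries row) :=
  derivable_comp AF (derivable_mulmx_prod _ hr (@subsetUr _ A B) ABM).
have ACL : derivable (r * 1 * 2) (A `|` entries row) (entries last).
  by apply: derivableW AL => // f; left.
have {}Arow := derivable_trans Arow ACL.
set C := _ `|` _ in Arow.
have AC : derivable (1 * 1 * (2 * r)) (A `|` C)
    (entries (fun t => row t *m last t)).
  by apply: derivable_mulmx => // f; right; [left|right].
apply: derivableW (derivable_comp Arow AC) => // [|_ ->]; last by exists (0, 0).
(* The total is [2r] for the first core, [4r^2] for each of the [d - 2] middle modes, [2r] for the
   last core and [2r] for the final dot product. It fits the bound because [6r <= 8r^2] when
   [r >= 1]. *)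
rewrite /index_enum -enumT size_enum_ord -{2}(subnK hd) -mulnn.
by move: (d - 2)%N hr => m; clear; nia.
Qed.

Theorem theorem1 (R : realType) :
  exists C : nat, forall (d r : nat) (hd : (2 <= d)%N) (hr : (1 <= r)%N),
    exists p : slp (tt_input d r),
      (flops p <= C * (r ^ 2 * d))%N /\
      forall (W : tensor R d) (G : tt_cores R d r) (x : 'rV[R]_d),
        in_tt_format hd W G ->
        eval_slp (tt_input_value G x) p = model_response W x.
Proof.
exists 4 => d r hd hr.
have [p np pE] := derivable_slp (@derivable_model R _ _ hd hr).
exists p; split=> // W G x WG.
(* The program was fixed before [G] and [x]; they enter only as the parameter [(G, x)] of its
   correctness statement. *)
by rewrite (model_response_factor x WG) (pE (G, x)).
Qed.
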